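(* Let $L$ be a torsion-free Lie algebra over $\mathbb{C}[\![t]\!]$, finitely generated as a $\mathbb{C}[\![t]\!]$-module, with $\mathbb{C}[\![t]\!]$-basis $\{x_1,\ldots,x_d\}$, and let $*\in\{\le,\triangleleft\}$. Suppose $C$ is a set of removable pairs $(i,j)$ (with $1\le i<j\le d$). Then $$R_L^*(T)=\sum_{\mathbf{n}\in\mathbb{Z}_{\ge 0}^{d}} \chi(\mathcal{E}_{\mathbf{n},C}\cap\mathcal{F}_{\mathbf{n}}^* )\, T^{n_1+\cdots+n_d}.$$
   Context: Reduced zeta function: let $\chi$ be the Euler characteristic on constructible sets over $\mathbb{C}$ (the unique integer-valued function with $\chi(\mathbb{C}^m)=1$, additive on disjoint constructible sets, and with $\chi(B)=e\chi(A)$ whenever $f:B\to A$ is a constructible map all of whose fibres have Euler characteristic $e$). For $n\ge0$ let $B_n^{\le}$ (resp. $B_n^{\triangleleft}$) be the constructible subset of the Grassmannian $\mathrm{Gr}(L/t^nL)$ consisting of the $\mathbb{C}[\![t]\!]$-submodules of $L$ of $\mathbb{C}$-codimension $n$ that are subalgebras (resp. ideals); then $R_L^*(T)=\sum_{n\ge0}\chi(B_n^* )T^n$ (this equals $\chi$ applied coefficientwise to the motivic zeta function $\sum_n [B_n^*]T^n$). Write elements of $L$ as row vectors of coordinates in the basis $\{x_1,\dots,x_d\}$. For $\mathbf{n}=(n_1,\ldots,n_d)\in\mathbb{Z}_{\ge0}^d$, let $\mathcal{T}_{\mathbf{n}}$ be the set of upper triangular $d\times d$ matrices with diagonal entries $t^{n_1},\ldots,t^{n_d}$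 and entries $a_{ij}$ ($i<j$) which are polynomials in $t$ with complex coefficients of degree $<n_j$; writing $a_{ij}=\sum_{l=0}^{n_j-1}a_{ij}^{(l)}t^l$, $\mathcal{T}_{\mathbf{n}}$ is identified with complex affine space in the coordinates $a_{ij}^{(l)}$. For $M\in\mathcal{T}_{\mathbf{n}}$, $\Xi(M)$ is the $\mathbb{C}[\![t]\!]$-submodule of $L$ spanned by its rows. $\mathcal{F}^{\le}_{\mathbf{n}}$ (resp. $\mathcal{F}^{\triangleleft}_{\mathbf{n}}$) is the constructible subset of $\mathcal{T}_{\mathbf{n}}$ of those $M$ with $\Xi(M)$ a subalgebra (resp. ideal) of $L$. For a set $C$ of pairs, $\mathcal{E}_{\mathbf{n},C}$ is the subvariety of $\mathcal{T}_{\mathbf{n}}$ where $a_{ij}=0$ for all $(i,j)\in C$. A pair $(i,j)$, $1\le i<j\le d$, is removable if there exist integers $l_1,\ldots,l_d$ with $l_i\ne l_j$ such that for every $z\in\mathbb{C}^*$ the $\mathbb{C}[\![t]\!]$-linear map $x_r\mapsto z^{l_r}x_r$ ($r=1,\ldots,d$) is an automorphism of $L$. *)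

(* Defs.v *)
From HB Require Import structures.
From mathcomp Require Import all_boot all_order all_algebra.
From mathcomp Require Import complex Rstruct.
From Stdlib Require Import Rdefinitions.

Set Implicit Arguments.
Unset Strict Implicit.
Unset Printing Implicit Defensive.

Import Order.TTheory GRing.Theory Num.Theory.
Local Open Scope ring_scope.

Definition C : closedFieldType := complex Rdefinitions.R.

Inductive polyfun (I : finType) : ((I -> C) -> C) -> Prop :=
| pf_const (c : C) : polyfun (fun _ => c)
| pf_coord (i : I) : polyfun (fun x => x i)
| pf_add p q : polyfun p -> polyfun q -> polyfun (fun x => p x + q x)
| pf_mul p q : polyfun p -> polyfun q -> polyfun (fun x => p x * q x).

Inductive constructible (I : finType) : ((I -> C) -> Prop) -> Prop :=
| cons_zero p : polyfun p -> constructible (fun x => p x = 0)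
| cons_compl A : constructible A -> constructible (fun x => ~ A x)
| cons_inter A B : constructible A -> constructible B ->
    constructible (fun x => A x /\ B x)
| cons_ext A B : (forall x, A x <-> B x) -> constructible A -> constructible B.

Definition constructible_map (I J : finType) (B : (I -> C) -> Prop)
    (f : (I -> C) -> (J -> C)) : Prop :=
  constructible (fun z : (I + J)%type -> C =>
    B (fun i => z (inl i)) /\ f (fun i => z (inl i)) = (fun j => z (inr j))).

Definition is_euler_char (chi : forall I : finType, ((I -> C) -> Prop) -> int)
  : Prop :=
  [/\ (forall I : finType, chi I (fun _ => True) = 1),
      (forall (I : finType) (A B : (I -> C) -> Prop),
         constructible A -> constructible B -> (forall x, A x -> ~ B x) ->
         chi I (fun x => A x \/ B x) = chi I A + chi I B) &
      (forall (I J : finType) (B : (I -> C) -> Prop) (A : (J -> C) -> Prop)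
              (f : (I -> C) -> (J -> C)) (e : int),
         constructible B -> constructible A ->
         (forall x, B x -> A (f x)) -> constructible_map B f ->
         (forall a, A a -> chi I (fun x => B x /\ f x = a) = e) ->
         chi I B = e * chi J A)].

Definition ps := nat -> C.
Definition psmul (a b : ps) : ps :=
  fun n => \sum_(k < n.+1) a k * b (n - k)%nat.

(* Elements of L = C[[t]]^d (coordinates in the basis x_1..x_d). *)
Definition lie (d : nat) := 'I_d -> ps.
Definition lzero d : lie d := fun _ _ => 0.
Definition ladd d (u v : lie d) : lie d := fun i n => u i n + v i n.
Definition lscale d (a : ps) (u : lie d) : lie d := fun i => psmul a (u i).

(* Structure constants: [x_i, x_j] = sum_k c i j k x_k. *)
Definition sconst (d : nat) := 'I_d -> 'I_d -> 'I_d -> ps.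

Definition lbr d (c : sconst d) (u v : lie d) : lie d :=
  fun k n => \sum_(i < d) \sum_(j < d) psmul (psmul (u i) (v j)) (c i j k) n.

(* c defines a Lie algebra over C[[t]] (the bracket is C[[t]]-bilinear by
   construction): alternating and Jacobi identity. *)
Definition is_lie_algebra d (c : sconst d) : Prop :=
  (forall u, lbr c u u = @lzero d) /\
  (forall u v w, ladd (lbr c u (lbr c v w))
                  (ladd (lbr c v (lbr c w u)) (lbr c w (lbr c u v))) = @lzero d).

Definition submodule d (M : lie d -> Prop) : Prop :=
  [/\ M (@lzero d), (forall u v, M u -> M v -> M (ladd u v)) &
      (forall a u, M u -> M (lscale a u))].

Definition subalgebra d (c : sconst d) (M : lie d -> Prop) : Prop :=
  submodule M /\ (forall u v, M u -> M v -> M (lbr c u v)).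

Definition lie_ideal d (c : sconst d) (M : lie d -> Prop) : Prop :=
  submodule M /\ (forall u v, M v -> M (lbr c u v)).

Inductive kind := Subalg | Ideal.

Definition closed_kind d (c : sconst d) (k : kind) (M : lie d -> Prop) :=
  match k with Subalg => subalgebra c M | Ideal => lie_ideal c M end.

Definition lie_aut d (c : sconst d) (f : lie d -> lie d) : Prop :=
  [/\ bijective f,
      (forall u v, f (ladd u v) = ladd (f u) (f v)),
      (forall a u, f (lscale a u) = lscale a (f u)) &
      (forall u v, f (lbr c u v) = lbr c (f u) (f v))].

Definition diag_scale d (z : C) (l : 'I_d -> int) (u : lie d) : lie d :=
  fun r n => z ^ (l r) * u r n.

Definition removable d (c : sconst d) (i j : 'I_d) : Prop :=
  exists l : 'I_d -> int, l i != l j /\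
    forall z : C, z != 0 -> lie_aut c (diag_scale z l).

(* A point of Gr_k(C^J) (J a finite ordered index set, ordered by the
   enumeration of J) is represented by the unique k x J matrix in reduced
   row echelon form with that row space. *)
Definition rref (k : nat) (J : finType) (A : 'I_k * J -> C) : Prop :=
  exists p : 'I_k -> J,
    [/\ (forall i i' : 'I_k, (nat_of_ord i < nat_of_ord i')%nat -> (nat_of_ord (enum_rank (p i)) < nat_of_ord (enum_rank (p i')))%nat),
        (forall i i' : 'I_k, A (i', p i) = (i == i')%:R) &
        (forall (i : 'I_k) (j : J), (nat_of_ord (enum_rank j) < nat_of_ord (enum_rank (p i)))%nat ->
            A (i, j) = 0)].

Definition rowspan (k : nat) (J : finType) (A : 'I_k * J -> C)
  : (J -> C) -> Prop :=
  fun v => exists b : 'I_k -> C, v = (fun j => \sum_(i < k) b i * A (i, j)).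

(* L/t^nL has C-basis t^l x_i (i < d, l < n); u mod t^n has coordinates
   u i l. *)
Definition trunc d (n : nat) (u : lie d) : 'I_d * 'I_n -> C :=
  fun p => u p.1 p.2.

(* B_n^*: the C[[t]]-submodules of L of C-codimension n (these contain
   t^n L, so they are the preimages of (dn - n)-dimensional subspaces W of
   L/t^nL) that are subalgebras/ideals, as a subset of the Grassmannian
   Gr_(dn-n)(L/t^nL), in RREF coordinates. *)
Definition Bset d (c : sconst d) (k : kind) (n : nat)
  : ('I_(d * n - n) * ('I_d * 'I_n) -> C) -> Prop :=
  fun A => [/\ (n <= d * n)%nat, rref A &
              closed_kind c k (fun u => rowspan A (@trunc d n u))].

Definition Tidx d (n : 'I_d -> nat) : finType :=
  {x : 'I_d * 'I_d * 'I_(\sum_(i < d) n i) | (nat_of_ord x.1.1 < nat_of_ord x.1.2)%nat && (x.2 < n x.1.2)%nat}.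

(* The coefficient a_ij^(l) (0 if (i,j,l) is not a coordinate). *)
Definition Tcoef d (n : 'I_d -> nat) (a : Tidx n -> C) (i j : 'I_d) (l : nat) : C :=
  match @idP (l < \sum_(i < d) n i)%nat with
  | ReflectT h => oapp a 0 (insub ((i, j), Ordinal h) : option (Tidx n))
  | ReflectF _ => 0
  end.

Definition Trow d (n : 'I_d -> nat) (a : Tidx n -> C) (i : 'I_d) : lie d :=
  fun j l => if i == j then (l == n i)%:R
             else if (nat_of_ord i < nat_of_ord j)%nat then Tcoef a i j l else 0.

Definition Xi d (n : 'I_d -> nat) (a : Tidx n -> C) : lie d -> Prop :=
  fun u => exists b : 'I_d -> ps,
    u = (fun j m => \sum_(i < d) psmul (b i) (Trow a i j) m).

Definition EFset d (c : sconst d) (k : kind) (Cp : 'I_d -> 'I_d -> Prop)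
    (n : 'I_d -> nat) : (Tidx n -> C) -> Prop :=
  fun a => (forall x : Tidx n, Cp (val x).1.1 (val x).1.2 -> a x = 0) /\
           closed_kind c k (Xi a).

(* Main.v *)
Require Import Defs.
From mathcomp Require Import all_boot all_order all_algebra.
From mathcomp Require Import boolp.
From mathcomp Require Import zify.

(** Every submodule of codimension [m] has a unique upper triangular basis in
    some [T_n] with [n_1 + ... + n_d = m].  Ordering the monomials [t^l x_i]
    lexicographically, its reduced row echelon form modulo [t^m] has pivots
    exactly the [t^l x_i] with [n_i <= l < m], and the row at the pivot
    [t^(n_i) x_i] is the [i]-th row of the triangular matrix.  So the coordinates
    of [T_n] are a coordinate projection of those of the Grassmannian, and the
    inverse is polynomial because reducing [t^l] times a row is; hence
    [chi (B_m)] is the sum of the [chi (F_n)].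

    A removable pair [(i, j)] gives a torus acting on [F_n] by scaling the
    coordinates, with nonzero weight on those of [a_ij].  The locus where such a
    coordinate is nonzero fibres over the punctured line with isomorphic fibres,
    so it has [chi = 0], and the coordinate may be set to zero.  Doing this one
    coordinate at a time treats any set of removable pairs. *)

Set Implicit Arguments.
Unset Strict Implicit.
Unset Printing Implicit Defensive.

Import GRing.Theory.
Local Open Scope ring_scope.

(* Otherwise simplification unfolds the field structure of [C], after which
   algebraic lemmas no longer match. *)
Local Opaque C.

(** * Constructible sets and the Euler characteristic *)

Lemma polyfun_sum (I K : finType) (P : pred K) (F : K -> (I -> C) -> C) :
  (forall k, polyfun (F k)) -> polyfun (fun x => \sum_(k | P k) F k x).
Proof.
move=> polyF; rewrite unlock; elim: (index_enum K) => [|k s IHs] /=.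
  exact: pf_const.
by case: (P k) => //; apply: pf_add.
Qed.

Lemma polyfun_sub (I : finType) (p q : (I -> C) -> C) :
  polyfun p -> polyfun q -> polyfun (fun x => p x - q x).
Proof.
move=> polyp polyq.
rewrite (_ : (fun _ => _) = fun x => p x + (-1) * q x).
  by apply: pf_add => //; apply: pf_mul => //; apply: pf_const.
by apply/funext => x; rewrite mulN1r.
Qed.

Definition polymap (I J : finType) (f : (I -> C) -> J -> C) : Prop :=
  forall j, polyfun (fun x => f x j).

Lemma polyfun_comp (I J : finType) (p : (J -> C) -> C) (f : (I -> C) -> J -> C) :
  polyfun p -> polymap f -> polyfun (fun x => p (f x)).
Proof.
move=> polyp polyf; elim: polyp => {p} [c|j|p q _ IHp _ IHq|p q _ IHp _ IHq].
- exact: pf_const.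
- exact: polyf.
- exact: pf_add.
- exact: pf_mul.
Qed.

Lemma constructible_preim (I J : finType) (A : (J -> C) -> Prop)
    (f : (I -> C) -> J -> C) :
  constructible A -> polymap f -> constructible (fun x => A (f x)).
Proof.
move=> consA polyf.
elim: consA => {A} [p polyp|A _ IHA|A B _ IHA _ IHB|A B AB _ IHA].
- by apply: cons_zero; apply: polyfun_comp.
- exact: cons_compl.
- exact: cons_inter.
- by apply: cons_ext IHA => x.
Qed.

Lemma constructible_eq (I : finType) (p q : (I -> C) -> C) :
  polyfun p -> polyfun q -> constructible (fun x => p x = q x).
Proof.
move=> polyp polyq; apply: cons_ext (cons_zero (polyfun_sub polyp polyq)) => x.
by split=> [/subr0_eq|->] //; rewrite subrr.
Qed.

Lemma constructible_const (I : finType) (P : Prop) :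
  constructible (fun _ : I -> C => P).
Proof.
have consT : constructible (fun _ : I -> C => True).
  by apply: cons_ext (cons_zero (pf_const I 0)).
have [p|np] := pselect P; first exact: cons_ext consT.
by apply: cons_ext (cons_compl consT) => x; split.
Qed.

Lemma constructible_all (I K : finType) (P : K -> (I -> C) -> Prop) :
  (forall k, constructible (P k)) -> constructible (fun x => forall k, P k x).
Proof.
move=> consP.
suff: constructible (fun x => forall k, k \in enum K -> P k x).
  by apply: cons_ext => x; split=> Px k; [apply: Px; rewrite mem_enum|].
elim: (enum K) => [|k s IHs].
  by apply: cons_ext (constructible_const I True).
apply: cons_ext (cons_inter (consP k) IHs) => x; split=> [[Pk Ps] j|Ps].
  by rewrite inE => /predU1P[->|/Ps].
by split=> [|j js]; apply: Ps; rewrite inE ?eqxx ?js ?orbT.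
Qed.

Lemma constructible_imp (I : finType) (A : (I -> C) -> Prop) (P : Prop) :
  constructible A -> constructible (fun x => P -> A x).
Proof.
move=> consA; have [p|np] := pselect P.
  by apply: cons_ext consA => x; split=> [|/(_ p)].
by apply: cons_ext (constructible_const I True).
Qed.

Lemma constructible_polymap (I J : finType) (B : (I -> C) -> Prop)
    (f : (I -> C) -> J -> C) :
  constructible B -> polymap f -> constructible_map B f.
Proof.
move=> consB polyf.
have polyl : polymap (fun (z : (I + J)%type -> C) i => z (inl i)).
  by move=> i; apply: pf_coord.
apply: cons_inter; first exact: (constructible_preim consB polyl).
have cons_f : forall j, constructible
    (fun z : (I + J)%type -> C => f (fun i => z (inl i)) j = z (inr j)).
  move=> j; apply: constructible_eq (pf_coord _).
  exact: (polyfun_comp (polyf j) polyl).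
apply: cons_ext (constructible_all cons_f) => z; split=> [fz|fz j].
  exact/funext.
by rewrite fz.
Qed.

Lemma constructible_point (I : finType) (a : I -> C) :
  constructible (fun x => x = a).
Proof.
have cons_a i : constructible (fun x : I -> C => x i = a i).
  by apply: constructible_eq; [apply: pf_coord|apply: pf_const].
apply: cons_ext (constructible_all cons_a) => x.
by split=> [/funext|->].
Qed.

(** Algebraic closedness gives roots for positive exponents; a negative exponent is handled by
    inverting [s]. Thus the torus reaches every nonzero value of a coordinate of nonzero weight. *)
Lemma exprz_surj (F : closedFieldType) (e : int) (s : F) : e != 0 -> s != 0 ->
  exists2 z : F, z != 0 & z ^ e = s.
Proof.
move=> e0 s0.
have root n (u : F) : (0 < n)%N -> u != 0 -> exists2 z : F, z != 0 & z ^+ n = u.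
  move=> n0 u0.
  (* The equation is [z^n = u]: the lower-order side has only its constant coefficient. *)
  have [z] := GRing.Theory.solve_monicpoly (fun i => if i == 0%N then u else 0) n0.
  case: n n0 => // n _; rewrite big_ord_recl /= mulr1 big1 ?addr0 => [zu|i _].
    by exists z => //; apply: contraNneq u0 => z0; rewrite -zu z0 expr0n.
  by rewrite mul0r.
case: e e0 => [n|n] e0.
  have [|z z0 zs] := root n s _ s0; last by exists z.
  by rewrite lt0n.
have [||z z0 zs] := root n.+1 s^-1; rewrite ?invr_eq0 //.
by exists z => //; rewrite NegzE -exprnN zs invrK.
Qed.

Section EulerCharacteristic.

Variable chi : forall I : finType, ((I -> C) -> Prop) -> int.
Hypothesis chiP : is_euler_char chi.

Lemma chi_ext (I : finType) (A B : (I -> C) -> Prop) :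
  (forall x, A x <-> B x) -> chi A = chi B.
Proof. by move=> /predeqP->. Qed.

Lemma chi_disjU (I : finType) (A B : (I -> C) -> Prop) :
  constructible A -> constructible B -> (forall x, A x -> ~ B x) ->
  chi (fun x => A x \/ B x) = chi A + chi B.
Proof. by case: chiP => _ + _; apply. Qed.

(** The empty set is the disjoint union of itself with itself, so additivity forces the value 0. *)
Lemma chi_empty (I : finType) (A : (I -> C) -> Prop) :
  (forall x, ~ A x) -> chi A = 0.
Proof.
move=> nA; have consF := constructible_const I False.
rewrite (@chi_ext _ A (fun _ => False)); last by move=> x; split=> // /nA.
apply: (@addrI _ (chi (fun _ : I -> C => False))).
rewrite -chi_disjU // addr0; apply: chi_ext => x; tauto.
Qed.

Lemma chi_setD (I : finType) (A B : (I -> C) -> Prop) :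
  constructible A -> constructible B ->
  chi A = chi (fun x => A x /\ B x) + chi (fun x => A x /\ ~ B x).
Proof.
move=> consA consB; rewrite -chi_disjU.
- by apply: chi_ext => x; have [] := pselect (B x); tauto.
- exact: cons_inter.
- by apply: cons_inter => //; apply: cons_compl.
- by move=> x [_ Bx] [].
Qed.

(* [C^0] is a point, which the fibration axiom compares with any other one. *)
Lemma chi_point (I : finType) (a : I -> C) : chi (fun x => x = a) = 1.
Proof.
have [chiT _ chi_fib] := chiP.
have := chi_fib void I (fun _ => True) (fun x => x = a) (fun _ => a) 1
          (constructible_const _ _) (constructible_point a).
rewrite chiT mul1r => <- //.
- apply: constructible_polymap; first exact: constructible_const.
  by move=> i; apply: pf_const.
- by move=> _ ->; rewrite -(chiT void); apply: chi_ext.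
Qed.

(** The fibration axiom is applied to [f] alone; [g] only identifies each fibre of [f] with a point,
    of characteristic 1. *)
Lemma chi_bij (I J : finType) (B : (I -> C) -> Prop) (A : (J -> C) -> Prop)
    (f : (I -> C) -> J -> C) (g : (J -> C) -> I -> C) :
  constructible B -> constructible A -> polymap f ->
  (forall x, B x -> A (f x)) -> (forall y, A y -> B (g y)) ->
  (forall x, B x -> g (f x) = x) -> (forall y, A y -> f (g y) = y) ->
  chi B = chi A.
Proof.
move=> consB consA polyf fA gB gf fg; have [_ _ chi_fib] := chiP.
rewrite (chi_fib I J B A f 1) ?mul1r //; first exact: constructible_polymap.
move=> y Ay; rewrite -(chi_point (g y)); apply: chi_ext => x.
by split=> [[Bx <-]|->]; [rewrite gf | rewrite fg //; split=> //; apply: gB].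
Qed.

Lemma chi_sum (I : finType) (T : eqType) (s : seq T) (A : T -> (I -> C) -> Prop) :
  uniq s -> (forall t, constructible (A t)) ->
  (forall t t' x, A t x -> A t' x -> t = t') ->
  chi (fun x => exists2 t, t \in s & A t x) = \sum_(t <- s) chi (A t).
Proof.
move=> + consA disjA; elim: s => [_|t s IHs /= /andP[nts us]].
  by rewrite big_nil; apply: chi_empty => x [].
have cons_s : constructible (fun x => exists2 t, t \in s & A t x).
  (* A finite union is the complement of an intersection of complements. *)
  apply: cons_ext (cons_compl (constructible_all
    (fun i : 'I_(size s) => cons_compl (consA (tnth (in_tuple s) i))))) => x.
  split=> [|[t' /(nthP t)[i lti <-] At] /(_ (Ordinal lti))].
    move=> /existsNP[i /contrapT Ai]; exists (tnth (in_tuple s) i) => //.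
    exact: mem_tnth.
  by rewrite (tnth_nth t); apply.
rewrite big_cons -IHs // -chi_disjU //.
  apply: chi_ext => x; split=> [[t' + At']|[At|[t' ts At']]].
  - by rewrite inE => /predU1P[<-|ts]; [left | right; exists t'].
  - by exists t => //; apply: mem_head.
  - by exists t' => //; rewrite inE ts orbT.
by move=> x At [t' ts At']; move: nts; rewrite (disjA _ _ _ At At') ts.
Qed.

Definition torus_act (I : finType) (w : I -> int) (z : C) (a : I -> C) : I -> C :=
  fun x => z ^ (w x) * a x.

Lemma torus_actK (I : finType) (w : I -> int) (z : C) :
  z != 0 -> cancel (torus_act w z) (torus_act w z^-1).
Proof.
move=> z0 a; apply/funext => x; rewrite /torus_act mulrA -expfzMl mulVf //.
by rewrite exp1rz mul1r.
Qed.

Lemma torus_act_polymap (I : finType) (w : I -> int) (z : C) :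
  polymap (torus_act w z).
Proof. by move=> x; apply: pf_mul; [apply: pf_const | apply: pf_coord]. Qed.

(* The coordinate [x0] maps [Z] onto a subset of the punctured line, over which the torus
   permutes the fibres transitively, and the punctured line has [chi = 0]. *)
Lemma chi_torus_act (I : finType) (w : I -> int) (x0 : I)
    (Z : (I -> C) -> Prop) :
  constructible Z -> w x0 != 0 ->
  (forall z a, z != 0 -> Z a -> Z (torus_act w z a)) ->
  (forall a, Z a -> a x0 != 0) -> chi Z = 0.
Proof.
move=> consZ w0 Zact Z0; have [chiT _ chi_fib] := chiP.
pose A (y : unit -> C) := ~ y = fun=> 0.
have consA : constructible A by apply/cons_compl/constructible_point.
have chiA : chi A = 0.
  (* The line is the disjoint union of the origin and [A]; the line and the origin both have
     [chi = 1]. *)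
  apply: (@addrI _ (chi (fun y : unit -> C => y = fun=> 0))).
  rewrite -chi_disjU //; [|exact: constructible_point|by move=> y ->].
  rewrite addr0 chi_point -(chiT unit); apply: chi_ext => y; split=> // _.
  by have [] := pselect (y = fun=> 0); [left | right].
pose f (a : I -> C) : unit -> C := fun=> a x0.
have polyf : polymap f by move=> ?; apply: pf_coord.
have cons_fib y : constructible (fun a => Z a /\ f a = y).
  apply: cons_inter => //; exact: (constructible_preim (constructible_point y) polyf).
rewrite (chi_fib I unit Z A f (chi (fun a => Z a /\ f a = fun=> 1))) //.
- by rewrite chiA mulr0.
- by move=> a /Z0 /eqP a0 /(congr1 (@^~ tt)).
- exact: constructible_polymap.
move=> y Ay; have y0 : y tt != 0.
  by apply/eqP => y0; apply: Ay; apply/funext => -[].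
have [z z0 zy] := exprz_surj w0 y0.
have zV0 : z^-1 != 0 by rewrite invr_eq0.
have zVy : z^-1 ^ (w x0) * y tt = 1.
  by rewrite -zy -expfzMl mulVf // exp1rz.
apply: (chi_bij (f := torus_act w z^-1) (g := torus_act w z)) => //.
- exact: torus_act_polymap.
- move=> a [Za fa]; split; first exact: Zact.
  by apply/funext => -[]; rewrite /f /torus_act -zVy -fa.
- move=> a [Za fa]; split; first exact: Zact.
  apply/funext => -[]; rewrite /f /torus_act zy.
  by move: fa => /(congr1 (@^~ tt)); rewrite /f => ->; rewrite mulr1.
- by move=> a _; rewrite -{1}(invrK z) torus_actK.
- by move=> a _; rewrite torus_actK.
Qed.

End EulerCharacteristic.

(** * Power series and submodules *)

(** Each coefficient of a product of series is one of a product of truncations, so commutativity and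
    associativity come from [{poly C}]. *)
Definition pspoly (N : nat) (a : ps) : {poly C} := \poly_(i < N) a i.

Lemma psmul_pspoly (N : nat) (a b : ps) (n : nat) : (n < N)%N ->
  psmul a b n = (pspoly N a * pspoly N b)`_n.
Proof.
move=> ltnN; rewrite coefM; apply: eq_bigr => k _; rewrite !coef_poly.
have kn := ltn_ord k; rewrite !ifT //; lia.
Qed.

Lemma psmulC (a b : ps) : psmul a b = psmul b a.
Proof.
by apply/funext => n; rewrite !(psmul_pspoly _ _ (ltnSn n)) mulrC.
Qed.

Lemma psmulA (a b e : ps) : psmul a (psmul b e) = psmul (psmul a b) e.
Proof.
apply/funext => n; transitivity ((pspoly n.+1 a * (pspoly n.+1 b * pspoly n.+1 e))`_n).
  rewrite coefM; apply: eq_bigr => k _; have kn := ltn_ord k.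
  by rewrite coef_poly kn -psmul_pspoly // ltnS leq_subr.
rewrite mulrA coefM; apply: eq_bigr => k _; have kn := ltn_ord k.
by rewrite coef_poly -psmul_pspoly // ltnS leq_subr.
Qed.

Lemma psmul_suml (K : finType) (b : K -> C) (a : K -> ps) (e : ps) :
  psmul (fun n => \sum_k b k * a k n) e =
  fun n => \sum_k b k * psmul (a k) e n.
Proof.
apply/funext => n; rewrite /psmul; under eq_bigr do rewrite big_distrl.
rewrite exchange_big; apply: eq_bigr => k _; rewrite big_distrr.
by apply: eq_bigr => l _; rewrite -[RHS]/(_ * _) mulrA.
Qed.

Lemma psmul_sumr (K : finType) (b : K -> C) (a : ps) (e : K -> ps) :
  psmul a (fun n => \sum_k b k * e k n) =
  fun n => \sum_k b k * psmul a (e k) n.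
Proof.
rewrite psmulC psmul_suml; apply/funext => n.
by apply: eq_bigr => k _; rewrite psmulC.
Qed.

Lemma psmulDl (a b e : ps) :
  psmul (fun n => a n + b n) e = fun n => psmul a e n + psmul b e n.
Proof.
apply/funext => n; rewrite /psmul -big_split.
by apply: eq_bigr => k _; rewrite mulrDl.
Qed.

Lemma psmul_eqmod (m : nat) (a a' b b' : ps) :
  (forall n, (n < m)%N -> a n = a' n) -> (forall n, (n < m)%N -> b n = b' n) ->
  forall n, (n < m)%N -> psmul a b n = psmul a' b' n.
Proof.
move=> aa' bb' n nm; apply: eq_bigr => k _; have kn := ltn_ord k.
by rewrite aa' ?bb' //; lia.
Qed.

Definition psX (e : nat) : ps := fun n => (n == e)%:R.

Lemma sum_conv_delta (R : pzRingType) (e : nat) (a : nat -> R) (n : nat) :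
  \sum_(k < n.+1) (k == e :> nat)%:R * a (n - k)%N =
  if (e <= n)%N then a (n - e)%N else 0.
Proof.
case: leqP => [len|ltn].
  rewrite (bigD1 (Ordinal (n := n.+1) (m := e) len)) //= eqxx mul1r big1 ?addr0 //.
  by move=> k /negPf; rewrite -val_eqE /= => ->; rewrite mul0r.
rewrite big1 // => k _; have kn := ltn_ord k.
by rewrite (_ : (k == e :> nat) = false) ?mul0r //; lia.
Qed.

Lemma psmulX (e : nat) (a : ps) (n : nat) :
  psmul (psX e) a n = if (e <= n)%N then a (n - e)%N else 0.
Proof. exact: sum_conv_delta. Qed.

Lemma psmul_scaler (s : C) (a b : ps) :
  psmul a (fun n => s * b n) = fun n => s * psmul a b n.
Proof.
apply/funext => n; rewrite /psmul big_distrr.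
by apply: eq_bigr => k _; apply: mulrCA.
Qed.

Lemma psmul_const (s : C) (a : ps) :
  psmul (fun n => s * psX 0 n) a = fun n => s * a n.
Proof.
rewrite psmulC psmul_scaler; apply/funext => n.
by rewrite psmulC psmulX subn0.
Qed.

Definition lcomb d (K : finType) (b : K -> C) (U : K -> lie d) : lie d :=
  fun i n => \sum_k b k * U k i n.

Definition eqmod d (m : nat) (u v : lie d) : Prop :=
  forall i n, (n < m)%N -> u i n = v i n.

Lemma trunc_eqmod d m (u v : lie d) : trunc (n := m) u = trunc v <-> eqmod m u v.
Proof.
split=> [uv i n nm|uv].
  by have /= := congr1 (fun f => f (i, Ordinal nm)) uv.
by apply/funext => -[i n]; apply: uv.
Qed.

Lemma lscale_lcomb d (K : finType) a (b : K -> C) (U : K -> lie d) :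
  lscale a (lcomb b U) = lcomb b (fun k => lscale a (U k)).
Proof. by apply/funext => i; apply: psmul_sumr. Qed.

Lemma lbr_lcombl d (c : sconst d) (K : finType) (b : K -> C) (U : K -> lie d) v :
  lbr c (lcomb b U) v = lcomb b (fun k => lbr c (U k) v).
Proof.
apply/funext => k; apply/funext => n; rewrite /lbr /lcomb.
under eq_bigr => i _.
  under eq_bigr => j _ do rewrite psmul_suml psmul_suml.
  rewrite exchange_big; over.
rewrite exchange_big; apply: eq_bigr => s _; rewrite big_distrr.
by apply: eq_bigr => i _; rewrite -big_distrr.
Qed.

Lemma lbr_lcombr d (c : sconst d) (K : finType) (b : K -> C) u (V : K -> lie d) :
  lbr c u (lcomb b V) = lcomb b (fun k => lbr c u (V k)).
Proof.
apply/funext => k; apply/funext => n; rewrite /lbr /lcomb.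
under eq_bigr => i _.
  under eq_bigr => j _ do rewrite psmul_sumr psmul_suml.
  rewrite exchange_big; over.
rewrite exchange_big; apply: eq_bigr => s _; rewrite big_distrr.
by apply: eq_bigr => i _; rewrite -big_distrr.
Qed.

Lemma lscale_eqmod d m a (u v : lie d) :
  eqmod m u v -> eqmod m (lscale a u) (lscale a v).
Proof. by move=> uv i; apply: psmul_eqmod => // n; apply: uv. Qed.

Lemma lbr_eqmod d (c : sconst d) m (u u' v v' : lie d) :
  eqmod m u u' -> eqmod m v v' -> eqmod m (lbr c u v) (lbr c u' v').
Proof.
move=> uu' vv' k n nm; apply: eq_bigr => i _; apply: eq_bigr => j _.
apply: psmul_eqmod nm => // n'; apply: psmul_eqmod; [exact: uu'|exact: vv'].
Qed.

(** The scalar [s] acts as the constant power series [s * t^0]. *)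
Lemma submodule_const d (M : lie d -> Prop) (s : C) u :
  submodule M -> M u -> M (fun i n => s * u i n).
Proof.
case=> _ _ Mscale Mu; rewrite (_ : (fun _ => _) = lscale (fun n => s * psX 0 n) u).
  exact: Mscale.
by apply/funext => i; rewrite /lscale psmul_const.
Qed.

Lemma submodule_sum d (M : lie d -> Prop) (K : finType) (P : pred K) (U : K -> lie d) :
  submodule M -> (forall k, P k -> M (U k)) ->
  M (fun i n => \sum_(k | P k) U k i n).
Proof.
case=> M0 Madd _ MU; rewrite unlock.
elim: (index_enum K) => //= k s IHs.
by case: (boolP (P k)) => // /MU Mk; apply: (Madd (U k)).
Qed.

Lemma submodule_lcomb d (M : lie d -> Prop) (K : finType) (b : K -> C) (U : K -> lie d) :
  submodule M -> (forall k, M (U k)) -> M (lcomb b U).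
Proof.
move=> subM MU; apply: (submodule_sum (U := fun k i n => b k * U k i n)) => // k _.
exact: submodule_const.
Qed.

Lemma submodule_sub d (M : lie d -> Prop) (u v : lie d) :
  submodule M -> M u -> M v -> M (fun i n => u i n - v i n).
Proof.
move=> subM Mu Mv; have [_ Madd _] := subM.
rewrite (_ : (fun _ => _) = ladd u (fun i n => -1 * v i n)).
  by apply: Madd => //; apply: submodule_const.
by apply/funext => i; apply/funext => n; rewrite /ladd mulN1r.
Qed.

(** * Row spans in echelon form *)

(** The condition [rref] with its pivot map exposed, so that the Grassmannian can be cut up
    according to pivots. *)
Definition rref_at (K : nat) (J : finType) (p : 'I_K -> J) (A : 'I_K * J -> C) : Prop :=
  [/\ (forall i i' : 'I_K, (i < i')%N -> (enum_rank (p i) < enum_rank (p i'))%N),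
      (forall i i' : 'I_K, A (i', p i) = (i == i')%:R) &
      (forall (i : 'I_K) (j : J), (enum_rank j < enum_rank (p i))%N -> A (i, j) = 0)].

Lemma sum_delta (R : pzRingType) (K : finType) (b : K -> R) (k : K) :
  \sum_i b i * (k == i)%:R = b k.
Proof.
rewrite (bigD1 k) //= eqxx mulr1 big1 ?addr0 // => i /negPf.
by rewrite eq_sym => ->; rewrite mulr0.
Qed.

Section PivotSpan.

Variables (K : nat) (J : finType) (p : 'I_K -> J) (A : 'I_K * J -> C).
Hypothesis rrefA : rref_at p A.

(** The pivot columns form an identity matrix, so the coefficients of a vector in the row span are
    its own pivot entries. Membership becomes a system of equations without an existential
    quantifier. *)
Lemma rowspan_pivotP (v : J -> C) :
  rowspan A v <-> forall j, v j = \sum_k v (p k) * A (k, j).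
Proof.
case: rrefA => _ deltaA _; split=> [[b ->] j|vE]; last first.
  by exists (fun k => v (p k)); apply/funext.
apply: eq_bigr => k _; congr (_ * _).
by under eq_bigr do rewrite deltaA; rewrite sum_delta.
Qed.

(** With common pivots, expanding a row of [A'] in the rows of [A] has coefficients 0 and 1 only,
    hence returns the same row of [A]. *)
Lemma rref_at_inj (A' : 'I_K * J -> C) : rref_at p A' ->
  (forall k, rowspan A (fun j => A' (k, j))) -> A' = A.
Proof.
case=> _ deltaA' _ spanA'; apply/funext => -[k j].
have /rowspan_pivotP -> := spanA' k.
under eq_bigr => i _ do rewrite deltaA' mulrC eq_sym.
by rewrite sum_delta.
Qed.

End PivotSpan.

Definition lift d m (v : 'I_d * 'I_m -> C) : lie d :=
  fun i n => oapp (fun l => v (i, l)) 0 (insub n).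

Lemma liftE d m (v : 'I_d * 'I_m -> C) i (l : 'I_m) : lift v i l = v (i, l).
Proof. by rewrite /lift valK. Qed.

Lemma trunc_lift d m (v : 'I_d * 'I_m -> C) : trunc (lift v) = v.
Proof. by apply/funext => -[i l]; rewrite /trunc liftE. Qed.

Definition mrow d m K (A : 'I_K * ('I_d * 'I_m) -> C) (k : 'I_K) : lie d :=
  lift (fun j => A (k, j)).

(** For [j = (i, l)] this is the monomial [t^l x_i]. *)
Definition uvec d m (j : 'I_d * 'I_m) : lie d := lift (fun j' => (j' == j)%:R).

Definition preim_span d m K (A : 'I_K * ('I_d * 'I_m) -> C) : lie d -> Prop :=
  fun u => rowspan A (trunc u).

Lemma eqmod_uvec d m (u : lie d) :
  eqmod m u (lcomb (trunc u) (@uvec d m)).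
Proof.
apply/trunc_eqmod/funext => -[i l]; rewrite {2}/trunc /lcomb.
under eq_bigr => j _ do rewrite /uvec liftE.
by rewrite sum_delta.
Qed.

Lemma lscale_psX_eqmod d m a (u : lie d) :
  eqmod m (lscale a u) (lcomb (fun s : 'I_m => a s) (fun s => lscale (psX s) u)).
Proof.
move=> i n nm; transitivity (psmul (fun n => \sum_(s < m) a s * psX s n) (u i) n).
  apply: psmul_eqmod nm => // n' nm'.
  rewrite -[n']/(nat_of_ord (Ordinal nm')).
  by rewrite /psX -[LHS](sum_delta (fun s : 'I_m => a s)).
by rewrite psmul_suml.
Qed.

Section SpanClosed.

Variables (d m K : nat) (p : 'I_K -> 'I_d * 'I_m).
Variable A : 'I_K * ('I_d * 'I_m) -> C.
Hypothesis rrefA : rref_at p A.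

Lemma preim_span_eqmod u v : eqmod m u v -> preim_span A v -> preim_span A u.
Proof. by rewrite /preim_span => /trunc_eqmod->. Qed.

Lemma preim_span_lcomb (T : finType) (b : T -> C) (U : T -> lie d) :
  (forall t, preim_span A (U t)) -> preim_span A (lcomb b U).
Proof.
move=> MU; apply/(rowspan_pivotP rrefA) => j; rewrite /trunc /lcomb.
under [RHS]eq_bigr do rewrite big_distrl.
rewrite exchange_big; apply: eq_bigr => t _.
have /(rowspan_pivotP rrefA)/(_ j) := MU t; rewrite /trunc => ->.
by rewrite big_distrr; apply: eq_bigr => k _; apply: mulrA.
Qed.

Lemma preim_span_mrow k : preim_span A (mrow A k).
Proof.
rewrite /preim_span trunc_lift; exists (fun i => (k == i)%:R).
apply/funext => j; under eq_bigr do rewrite mulrC; by rewrite sum_delta.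
Qed.

Lemma preim_span_mrowP u : preim_span A u -> exists b, eqmod m u (lcomb b (mrow A)).
Proof.
case=> b uE; exists b; apply/trunc_eqmod; rewrite uE.
by apply/funext => -[i l]; apply: eq_bigr => k _; rewrite /mrow liftE.
Qed.

(** Modulo [t^m] a power series is a finite combination of powers of [t], so stability under scaling
    reduces to finitely many conditions on rows. *)
Lemma preim_span_submodule :
  submodule (preim_span A) <->
  forall (s : 'I_m) k, preim_span A (lscale (psX s) (mrow A k)).
Proof.
split=> [[_ _ Mscale] s k|Mgen]; first exact/Mscale/preim_span_mrow.
split.
- exists (fun=> 0); apply/funext => j; rewrite big1 // => k _; exact: mul0r.
- move=> u v [b bE] [b' b'E]; exists (fun k => b k + b' k).
  have -> : trunc (n := m) (ladd u v) = fun j => trunc u j + trunc v j by [].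
  rewrite bE b'E; apply/funext => j; rewrite -big_split.
  by apply: eq_bigr => k _; rewrite mulrDl.
- move=> a u /preim_span_mrowP[b ub].
  apply: preim_span_eqmod (lscale_eqmod a ub) _; rewrite lscale_lcomb.
  apply: preim_span_lcomb => k; apply: preim_span_eqmod (@lscale_psX_eqmod _ m a _) _.
  by apply: preim_span_lcomb => s.
Qed.

Variable c : sconst d.

(** A finite test for closure under the bracket, by bilinearity modulo [t^m]. For ideals the left
    argument runs over the monomials, which span [L] modulo [t^m L]. *)
Definition bracket_gens (k : kind) : Prop :=
  match k with
  | Subalg => forall i j, preim_span A (lbr c (mrow A i) (mrow A j))
  | Ideal => forall (i : 'I_d * 'I_m) j, preim_span A (lbr c (uvec i) (mrow A j))
  end.

Lemma preim_span_closed k :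
  closed_kind c k (preim_span A) <->
  (forall (s : 'I_m) k, preim_span A (lscale (psX s) (mrow A k))) /\
  bracket_gens k.
Proof.
rewrite -preim_span_submodule; case: k => /=; split=> -[subM Mbr]; split=> //.
- by move=> i j; apply: Mbr; apply: preim_span_mrow.
- move=> u v /preim_span_mrowP[b ub] /preim_span_mrowP[b' vb].
  apply: preim_span_eqmod (lbr_eqmod c ub vb) _; rewrite lbr_lcombl.
  by apply: preim_span_lcomb => i; rewrite lbr_lcombr; apply: preim_span_lcomb.
- by move=> i j; apply/Mbr/preim_span_mrow.
- move=> u v /preim_span_mrowP[b vb].
  apply: preim_span_eqmod (lbr_eqmod c (@eqmod_uvec _ m u) vb) _; rewrite lbr_lcombl.
  by apply: preim_span_lcomb => i; rewrite lbr_lcombr; apply: preim_span_lcomb.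
Qed.

End SpanClosed.

(** * Constructibility of the echelon matrices with prescribed pivots *)

Definition polylie d (I : finType) (U : (I -> C) -> lie d) : Prop :=
  forall i n, polyfun (fun x => U x i n).

Lemma polyfun_psmul (I : finType) (a b : (I -> C) -> ps) :
  (forall n, polyfun (fun x => a x n)) -> (forall n, polyfun (fun x => b x n)) ->
  forall n, polyfun (fun x => psmul (a x) (b x) n).
Proof. by move=> pa pb n; apply: polyfun_sum => k; apply: pf_mul. Qed.

Lemma polylie_lscale d (I : finType) a (U : (I -> C) -> lie d) :
  polylie U -> polylie (fun x => lscale a (U x)).
Proof.
move=> pU i; apply: polyfun_psmul => [n|]; [exact: pf_const | exact: pU].
Qed.

Lemma polylie_lbr d (c : sconst d) (I : finType) (U V : (I -> C) -> lie d) :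
  polylie U -> polylie V -> polylie (fun x => lbr c (U x) (V x)).
Proof.
move=> pU pV k n; apply: polyfun_sum => i; apply: polyfun_sum => j.
apply: polyfun_psmul => {n} n; last exact: pf_const.
by apply: polyfun_psmul; [exact: pU | exact: pV].
Qed.

Lemma polylie_lift d m (I : finType) (v : (I -> C) -> 'I_d * 'I_m -> C) :
  polymap v -> polylie (fun x => lift (v x)).
Proof.
move=> pv i n; rewrite /lift; case: insub => [l|] /=; [exact: pv | exact: pf_const].
Qed.

Lemma polylie_mrow d m K (k : 'I_K) :
  polylie (fun A : 'I_K * ('I_d * 'I_m) -> C => mrow A k).
Proof. by apply: polylie_lift => j; apply: pf_coord. Qed.

Definition Bset_at d (c : sconst d) (kd : kind) m K (p : 'I_K -> 'I_d * 'I_m)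
    (A : 'I_K * ('I_d * 'I_m) -> C) : Prop :=
  rref_at p A /\ closed_kind c kd (preim_span A).

Lemma constructible_Bset_at d (c : sconst d) kd m K (p : 'I_K -> 'I_d * 'I_m) :
  constructible (Bset_at c kd p).
Proof.
(* Membership in the row span as polynomial equations, with pivot entries as coefficients; this
   agrees with [rowspan] once [rref_at p A] holds. *)
pose pivot_span (U : ('I_K * ('I_d * 'I_m) -> C) -> lie d) A :=
  forall j, trunc (U A) j = \sum_k trunc (U A) (p k) * A (k, j).
have cons_span U : polylie U -> constructible (pivot_span U).
  move=> pU; apply: constructible_all => j; apply: constructible_eq; first exact: pU.
  by apply: polyfun_sum => k; apply: pf_mul; [exact: pU | exact: pf_coord].
have cons_rref : constructible (rref_at p).
  have cons1 := constructible_const ('I_K * ('I_d * 'I_m))%type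
    (forall i i' : 'I_K, (i < i')%N -> (enum_rank (p i) < enum_rank (p i'))%N).
  have cons2 : constructible (fun A : 'I_K * ('I_d * 'I_m) -> C =>
      forall i i', A (i', p i) = (i == i')%:R).
    do 2 apply: constructible_all => ?.
    by apply: constructible_eq; [apply: pf_coord | apply: pf_const].
  have cons3 : constructible (fun A : 'I_K * ('I_d * 'I_m) -> C =>
      forall (i : 'I_K) j, (enum_rank j < enum_rank (p i))%N -> A (i, j) = 0).
    do 2 apply: constructible_all => ?; apply: constructible_imp.
    by apply: constructible_eq; [apply: pf_coord | apply: pf_const].
  apply: cons_ext (cons_inter cons1 (cons_inter cons2 cons3)) => A.
  by split=> [[? []]|[]].
have cons_scale : constructible (fun A => forall (s : 'I_m) k,
    pivot_span (fun A => lscale (psX s) (mrow A k)) A).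
  do 2 apply: constructible_all => ?.
  exact/cons_span/polylie_lscale/polylie_mrow.
have cons_br : constructible (fun A => match kd with
    | Subalg => forall i j, pivot_span (fun A => lbr c (mrow A i) (mrow A j)) A
    | Ideal => forall (i : 'I_d * 'I_m) j,
        pivot_span (fun A => lbr c (uvec i) (mrow A j)) A
    end).
  case: kd; do 2 apply: constructible_all => ?; apply/cons_span/polylie_lbr;
    try exact: polylie_mrow.
  by apply: polylie_lift => ?; apply: pf_const.
apply: cons_ext (cons_inter cons_rref (cons_inter cons_scale cons_br)) => A.
split=> -[rrefA closedA]; split=> //; have spanP := rowspan_pivotP rrefA.
- case: closedA => scaleA brA; apply/(preim_span_closed rrefA); split.
    by move=> s k; apply/spanP/scaleA.
  by case: kd {cons_br} brA => brA i j; apply/spanP/brA.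
- have [scaleA brA] := (preim_span_closed rrefA c kd).1 closedA; split.
    by move=> s k; apply/spanP/scaleA.
  by case: kd {cons_br closedA} brA => brA i j; apply/spanP/brA.
Qed.

(** * Triangular matrices and their echelon forms *)

Definition lex d m (u v : 'I_d * 'I_m) : bool :=
  (u.1 < v.1)%N || (u.1 == v.1) && (u.2 < v.2)%N.

Lemma pairwise_ltn_enum k : pairwise (fun i j : 'I_k => (i < j)%N) (enum 'I_k).
Proof.
have := iota_ltn_sorted 0 k; rewrite sorted_pairwise; last exact: ltn_trans.
by rewrite -val_enum_ord pairwise_map.
Qed.

Lemma pairwise_lex_enum d m : pairwise (@lex d m) (enum {: 'I_d * 'I_m}).
Proof.
rewrite enumT unlock /= /prod_enum; move: (enum 'I_m) (pairwise_ltn_enum m) => s2 lt2.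
elim: (enum 'I_d) (pairwise_ltn_enum d) => //= x s1 IHs /andP[/allP ltx /IHs lt1].
rewrite pairwise_cat lt1 andbT pairwise_map; apply/andP; split.
  apply/allrelP => _ _ /mapP[y _ ->] /allpairsP[z [zs _ ->]].
  by rewrite /lex /= ltx.
by apply: sub_pairwise lt2 => y y' lty; rewrite /lex /= eqxx lty orbT.
Qed.

(** The enumeration is pairwise [lex]-increasing, which gives one direction; the other follows
    because [lex] is irreflexive and asymmetric. *)
Lemma enum_rank_lex d m (x y : 'I_d * 'I_m) :
  (enum_rank x < enum_rank y)%N = lex x y.
Proof.
have lex_rank (u v : 'I_d * 'I_m) : (enum_rank u < enum_rank v)%N -> lex u v.
  have lexP := elimT (pairwiseP u) (pairwise_lex_enum d m).
  move=> /lexP; rewrite !inE !nth_enum_rank -cardE; apply; exact: ltn_ord.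
apply/idP/idP => [/lex_rank //|lexxy].
rewrite ltnNge leq_eqVlt negb_or; apply/andP; split.
  apply: contraTneq lexxy => /val_inj/enum_rank_inj->.
  by rewrite /lex !ltnn andbF.
apply: contraTN lexxy => /lex_rank; rewrite /lex -!val_eqE /=; lia.
Qed.

Section HermiteRows.

Variables (d : nat) (n : 'I_d -> nat).
Implicit Types (a : Tidx n -> C) (i j : 'I_d).

Lemma TcoefE a i j l (h : (l < \sum_i n i)%N) :
  Tcoef a i j l = oapp a 0 (insub (i, j, Ordinal h)).
Proof.
rewrite /Tcoef; move: (@idP (l < _)%N) => r.
refine (match r as r' in reflect _ b return
  match r' with ReflectT h => _ | ReflectF _ => _ end = _
  with ReflectT h' => _ | ReflectF h' => _ end); last by case: h'.
by rewrite (bool_irrelevance h' h).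
Qed.

Lemma Tcoef_oob a i j l : ~~ (l < \sum_i n i)%N -> Tcoef a i j l = 0.
Proof.
move=> /negP nh; rewrite /Tcoef; move: (@idP (l < _)%N) => r.
by refine (match r as r' in reflect _ b return
  match r' with ReflectT h => _ | ReflectF _ => _ end = _
  with ReflectT h => _ | ReflectF _ => erefl end).
Qed.

Lemma Tcoef_coord a (x : Tidx n) : Tcoef a (val x).1.1 (val x).1.2 (val x).2 = a x.
Proof.
rewrite (TcoefE _ _ _ (ltn_ord (val x).2)).
rewrite (_ : ((val x).1.1, (val x).1.2, Ordinal _) = val x) ?valK //.
by case: x => [[[i j] l] Px] /=; congr (_, _, _); apply: val_inj.
Qed.

Lemma Tcoef_ge a i j l : (n j <= l)%N -> Tcoef a i j l = 0.
Proof.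
move=> njl; have [h|h] := boolP (l < \sum_i n i)%N; last exact: Tcoef_oob.
by rewrite (TcoefE _ _ _ h) insubF //=; apply/negP => /andP[_]; rewrite ltnNge njl.
Qed.

Lemma polyfun_Tcoef i j l : polyfun (fun a => Tcoef a i j l).
Proof.
have [h|h] := boolP (l < \sum_i n i)%N.
  rewrite (_ : (fun _ => _) = fun a => oapp a 0 (insub (i, j, Ordinal h))).
    case: insub => [x|] /=; [exact: pf_coord | exact: pf_const].
  by apply/funext => a; apply: TcoefE.
rewrite (_ : (fun _ => _) = fun=> 0); first exact: pf_const.
by apply/funext => a; apply: Tcoef_oob.
Qed.

Lemma Trow_diag a i l : Trow a i i l = (l == n i)%:R.
Proof. by rewrite /Trow eqxx. Qed.

Lemma Trow_lt a i j l : (j < i)%N -> Trow a i j l = 0.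
Proof.
move=> ji; rewrite /Trow ltnNge (ltnW ji) ifF //.
by apply/eqP => ij; rewrite ij ltnn in ji.
Qed.

Lemma Trow_ge a i j l : (n j <= l)%N -> Trow a i j l = (i == j)%:R * (l == n j)%:R.
Proof.
move=> njl; rewrite /Trow; case: eqP => [->|_]; first by rewrite mul1r.
by rewrite mul0r; case: ifP => // _; apply: Tcoef_ge.
Qed.

Lemma polylie_Trow i : polylie (fun a => Trow a i).
Proof.
move=> j l; rewrite /Trow; case: eqP => _; first exact: pf_const.
by case: (i < j)%N; [apply: polyfun_Tcoef | apply: pf_const].
Qed.

Lemma Xi_submodule a : submodule (Xi a).
Proof.
split.
- exists (fun=> fun=> 0); apply/funext => j; apply/funext => l.
  rewrite big1 // => i _; rewrite /psmul big1 // => k _; exact: mul0r.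
- move=> _ _ [b ->] [b' ->]; exists (fun i l => b i l + b' i l).
  apply/funext => j; apply/funext => l; rewrite /ladd -big_split.
  by apply: eq_bigr => i _; rewrite psmulDl.
- move=> s _ [b ->]; exists (fun i => psmul s (b i)).
  apply/funext => j; rewrite /lscale.
  have := psmul_sumr (fun=> 1) s (fun i => psmul (b i) (Trow a i j)).
  rewrite (_ : (fun l => \sum_k 1 * _) = fun l => \sum_i psmul (b i) (Trow a i j) l).
    by move=> ->; apply/funext => l; apply: eq_bigr => i _; rewrite mul1r psmulA.
  by apply/funext => l; apply: eq_bigr => i _; rewrite mul1r.
Qed.

Lemma Xi_Trow a i : Xi a (Trow a i).
Proof.
exists (fun k l => (i == k)%:R * psX 0 l); apply/funext => j; apply/funext => l.
under eq_bigr do rewrite psmul_const mulrC.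
by rewrite (sum_delta (fun k => Trow a k j l)).
Qed.

Lemma Xi_sub a (M : lie d -> Prop) : submodule M ->
  (forall i, M (Trow a i)) -> forall u, Xi a u -> M u.
Proof.
move=> subM MT _ [b ->]; have [_ _ Mscale] := subM.
by apply: (submodule_sum (U := fun i => lscale (b i) (Trow a i))) => // i _;
  apply: Mscale.
Qed.

(** Downward induction on [i]: [t^(e - n_i)] times row [i] is [t^e x_i] plus multiples of
    [t^(e - n_i) x_k] with [k > i], and [e - n_i] still dominates the sum of the exponents from [k]
    on. *)
Lemma Xi_monomial a i e : (\sum_(j < d | i <= j) n j <= e)%N ->
  Xi a (fun j l => (j == i)%:R * psX e l).
Proof.
have subXi := Xi_submodule a; have [_ _ Xi_scale] := subXi.
elim: {i}(d - i)%N {-2}i (leqnn (d - i)) e => [|s IHs] i di e le_e.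
  by have := ltn_ord i; lia.
have le_i j : (i < j)%N ->
    (n i + \sum_(k < d | j <= k) n k <= \sum_(k < d | i <= k) n k)%N.
  move=> ij; rewrite [leqRHS](bigD1 i) //= leq_add2l.
  rewrite big_mkcond [leqRHS]big_mkcond leq_sum // => k _.
  case: (leqP j k) => // jk; rewrite ifT // (leq_trans (ltnW ij) jk) /=.
  by apply: contraTneq jk => ->; rewrite -ltnNge.
have le_n : (n i <= e)%N.
  by apply: leq_trans le_e; rewrite (bigD1 i) //= leq_addr.
rewrite (_ : (fun _ => _) = fun j l => lscale (psX (e - n i)) (Trow a i) j l -
    \sum_(k < d | (i < k)%N) lscale (Trow a i k)
       (fun j l => (j == k)%:R * psX (e - n i) l) j l).
  apply: submodule_sub => //; first by apply/Xi_scale/Xi_Trow.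
  apply: (submodule_sum (U := fun k => lscale (Trow a i k)
    (fun j l => (j == k)%:R * psX (e - n i) l))) => // k ik.
  apply: Xi_scale; apply: IHs; first lia.
  by move: (le_i _ ik) le_e; lia.
apply/funext => j; apply/funext => l.
have scaleE k : lscale (Trow a i k) (fun j l => (j == k)%:R * psX (e - n i) l) j l =
    (j == k)%:R * psmul (psX (e - n i)) (Trow a i k) l.
  by rewrite /lscale psmul_scaler psmulC.
under [X in _ - X]eq_bigr do rewrite scaleE mulrC.
rewrite big_mkcond (eq_bigr (fun k : 'I_d => (if (i < k)%N then
   psmul (psX (e - n i)) (Trow a i k) l else 0) * (j == k)%:R)); last first.
  by move=> k _; case: ifP => //; rewrite mul0r.
rewrite sum_delta /lscale; case: ltngtP => [ij|ji|/val_inj eij].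
- by rewrite subrr -val_eqE gtn_eqF ?mul0r.
- rewrite -val_eqE ltn_eqF ?mul0r //.
  by rewrite psmulX Trow_lt // subr0; case: ifP.
subst j; rewrite eqxx mul1r subr0 psmulX Trow_diag /psX.
case: leqP => [le_l|lt_l]; first by congr ((nat_of_bool _)%:R); apply/eqP/eqP; lia.
by rewrite (_ : (l == e) = false) //; apply/eqP => h; lia.
Qed.

Lemma Xi_contains_tail a u : (forall j l, (l < \sum_i n i)%N -> u j l = 0) -> Xi a u.
Proof.
move=> u0; pose m := (\sum_i n i)%N; have [_ _ Xi_scale] := Xi_submodule a.
(* The shifted series is the part of [u i] of degree at least [m], divided by [t^m]. *)
have Xim i : Xi a (lscale (fun l => u i (l + m)%N) (fun j l => (j == i)%:R * psX m l)).
  apply/Xi_scale/Xi_monomial; rewrite big_mkcond leq_sum // => j _; by case: ifP.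
rewrite (_ : u = fun j l => \sum_i
    lscale (fun l => u i (l + m)%N) (fun j l => (j == i)%:R * psX m l) j l).
  by apply: (submodule_sum (U := fun i => lscale (fun l => u i (l + m)%N)
    (fun j l => (j == i)%:R * psX m l))) => //; apply: Xi_submodule.
apply/funext => j; apply/funext => l.
rewrite (bigD1 j) //= big1 ?addr0 => [|i /negPf ji].
  rewrite /lscale eqxx (_ : (fun l => 1 * _) = psX m).
    rewrite psmulC psmulX; case: leqP => [ml|/u0 //]; by rewrite subnK.
  by apply/funext => l'; rewrite mul1r.
rewrite /lscale /psmul big1 // => k _.
by rewrite eq_sym ji mul0r mulr0.
Qed.

Definition reduced (u : lie d) := forall j l, (n j <= l)%N -> u j l = 0.

(** Uniqueness of remainders, column by column from the left: once the earlier coefficients vanish,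
    column [i] of [u] is [b_i t^(n_i)], and reducedness kills [b_i]. *)
Lemma Xi_reduced a u : Xi a u -> reduced u -> u = @lzero d.
Proof.
case=> b -> red.
suff b0 s i : (i < s)%N -> b i = fun=> 0.
  apply/funext => j; apply/funext => l; rewrite big1 // => i _.
  rewrite (b0 i.+1) // /psmul big1 // => k _; exact: mul0r.
elim: s i => // s IHs i; rewrite ltnS => is_; apply/funext => l.
rewrite -(red i (l + n i)%N (leq_addl _ _)) (bigD1 i) //= big1 ?addr0.
  rewrite (_ : Trow a i i = psX (n i)); last by apply/funext => ?; apply: Trow_diag.
  by rewrite psmulC psmulX leq_addl addnK.
move=> k; rewrite -val_eqE neq_ltn => /orP[ki|ik]; rewrite /psmul big1 // => t _.
  by rewrite IHs ?mul0r // (leq_trans ki).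
by rewrite Trow_lt ?mulr0.
Qed.

(* [hrow a i s] is [t^s] times the [i]-th row, with every off-diagonal entry
   reduced below the degree of the diagonal entry of its column; one step of the
   recursion creates only the top degree terms, which one subtraction removes. *)
Fixpoint hrow a i (s : nat) : lie d :=
  if s is s'.+1 then
    let u := lscale (psX 1) (hrow a i s') in
    fun j l => u j l - \sum_(k < d | k != i) u k (n k) * Trow a k j l
  else Trow a i.

Lemma hrow_spec a i s :
  [/\ Xi a (hrow a i s), (forall j l, (j < i)%N -> hrow a i s j l = 0),
      (forall l, hrow a i s i l = (l == n i + s)%N%:R) &
      (forall j l, i != j -> (n j <= l)%N -> hrow a i s j l = 0)].
Proof.
elim: s => [|s [Xi_s lt_s diag_s ge_s]] /=.
  split; first exact: Xi_Trow.
  - by move=> j l; apply: Trow_lt.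
  - by move=> l; rewrite Trow_diag addn0.
  - by move=> j l /negPf ij njl; rewrite Trow_ge // ij mul0r.
set u := lscale _ _.
have uE j l : u j l = if (1 <= l)%N then hrow a i s j (l - 1)%N else 0.
  exact: psmulX.
have u_lt j l : (j < i)%N -> u j l = 0 by move=> ji; rewrite uE lt_s // if_same.
split.
- have [_ _ Xi_scale] := Xi_submodule a.
  apply: submodule_sub; [exact: Xi_submodule | exact: Xi_scale|].
  apply: (submodule_sum (U := fun k j l => u k (n k) * Trow a k j l)).
    exact: Xi_submodule.
  by move=> k _; apply: submodule_const; [exact: Xi_submodule | exact: Xi_Trow].
- move=> j l ji; rewrite u_lt // sub0r big1 ?oppr0 // => k _.
  have [kj|jk] := leqP k j; last by rewrite Trow_lt ?mulr0.
  by rewrite u_lt ?mul0r // (leq_ltn_trans kj).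
(* The corrections leave column [i] alone: for [k < i] the coefficient is zero, and for [k > i] row
   [k] vanishes there. *)
- move=> l; rewrite big1 => [|k].
    rewrite subr0 uE diag_s; case: l => [|l]; first by rewrite addnS.
    by rewrite subn1 addnS eqSS.
  rewrite -val_eqE neq_ltn => /orP[ki|ik]; first by rewrite u_lt ?mul0r.
  by rewrite Trow_lt ?mulr0.
(* In column [j] and degree at least [n_j], row [j] alone contributes, through [t^(n_j)]; it cancels
   the one possible term of [u] there. *)
- move=> j l ij njl; rewrite (bigD1 j) 1?eq_sym //= big1 => [|k /andP[_ /negPf kj]].
    rewrite addr0 Trow_ge // eqxx mul1r.
    case: eqP => [->|lnj]; first by rewrite mulr1 subrr.
    rewrite mulr0 subr0 uE; case: ltnP => // l0; apply: ge_s => //; lia.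
  by rewrite Trow_ge // kj mul0r mulr0.
Qed.

Lemma polylie_hrow i s : polylie (fun a => hrow a i s).
Proof.
elim: s => [|s IHs] /=; first exact: polylie_Trow.
have pu := polylie_lscale (psX 1) IHs.
move=> j l; apply: polyfun_sub; first exact: pu.
by apply: polyfun_sum => k; apply: pf_mul; [exact: pu | exact: polylie_Trow].
Qed.

Local Notation m := (\sum_i n i)%N.

Variables (K : nat) (p : 'I_K -> 'I_d * 'I_m).
Hypothesis p_mono : forall k k' : 'I_K,
  (k < k')%N -> (enum_rank (p k) < enum_rank (p k'))%N.
Hypothesis p_image : forall j : 'I_d * 'I_m, (exists k, p k = j) <-> (n j.1 <= j.2)%N.

Lemma pivot_ge k : (n (p k).1 <= (p k).2)%N.
Proof. exact: (p_image (p k)).1 (ex_intro _ k erefl). Qed.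

Lemma pivot_inj : injective p.
Proof.
move=> k k' pkk'; apply: ord_inj.
have [/p_mono|/p_mono|] := ltngtP k k'; by rewrite ?pkk' ?ltnn.
Qed.

(** The row with pivot [t^l x_i] comes from [t^(l - n_i)] times row [i]; [pivot_ge] makes the
    truncated subtraction exact. *)
Definition prow a k : lie d := hrow a (p k).1 ((p k).2 - n (p k).1).

Lemma prow_spec a k :
  [/\ Xi a (prow a k), (forall j l, (j < (p k).1)%N -> prow a k j l = 0),
      (forall l, prow a k (p k).1 l = (l == (p k).2)%:R) &
      (forall j l, (p k).1 != j -> (n j <= l)%N -> prow a k j l = 0)].
Proof.
have [? ? diag ?] := hrow_spec a (p k).1 ((p k).2 - n (p k).1); split=> // l.
by rewrite /prow diag subnKC ?pivot_ge.
Qed.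

Definition hermite_rref a : 'I_K * ('I_d * 'I_m) -> C :=
  fun x => prow a x.1 x.2.1 x.2.2.

Lemma hermite_rref_polymap : polymap hermite_rref.
Proof. by move=> x; apply: polylie_hrow. Qed.

Lemma hermite_rrefP a : rref_at p (hermite_rref a).
Proof.
split=> // [k k'|k [j l]]; rewrite /hermite_rref /=.
  have [_ _ diag ge] := prow_spec a k'.
  have [kk'|] := eqVneq (p k').1 (p k).1.
    rewrite -kk' diag -(inj_eq pivot_inj) -[p k == _]/(_ && _) kk' eqxx /=.
    by rewrite val_eqE.
  move=> npk; rewrite ge ?pivot_ge //.
  by rewrite (_ : (k == k') = false) //; apply: contraNF npk => /eqP->.
rewrite enum_rank_lex /lex /= => /orP[jk|/andP[/eqP-> jk]].
  by have [_ -> //] := prow_spec a k.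
have [_ _ -> _] := prow_spec a k.
by rewrite (_ : (_ == _) = false) // ltn_eqF.
Qed.

(** The rows [prow] and all of [t^m L] lie in [Xi a], which gives one inclusion. Conversely,
    clearing the pivot entries of an element of [Xi a] and then its tail leaves a reduced element,
    hence zero. *)
Lemma Xi_hermite_rref a u : Xi a u <-> preim_span (hermite_rref a) u.
Proof.
pose v b := lcomb b (prow a); have subXi := Xi_submodule a.
have Xiv b : Xi a (v b).
  by apply: submodule_lcomb => // k; have [] := prow_spec a k.
split=> [Xiu|[b uE]].
  exists (fun k => trunc u (p k)).
  pose w := (fun j l => u j l - v (fun k => trunc u (p k)) j l) : lie d.
  have Xiw : Xi a w by apply: submodule_sub.
  pose w0 := (fun j l => w j l - (if (l < m)%N then 0 else w j l)) : lie d.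
  have Xiw0 : Xi a w0.
    by apply: submodule_sub => //; apply: Xi_contains_tail => j l ->.
  have redw0 : reduced w0.
    move=> j l njl; rewrite /w0; case: ifP => lm; last by rewrite subrr.
    have [k pk] := (p_image (j, Ordinal lm)).2 njl.
    rewrite subr0 /w /v /lcomb (eq_bigr (fun k' => trunc u (p k') * (k == k')%:R)).
      by rewrite sum_delta pk subrr.
    move=> k' _; have [_ /(_ k k') + _] := hermite_rrefP a.
    by rewrite /hermite_rref /= pk => ->.
  apply/funext => -[j l]; apply/eqP; rewrite -subr_eq0; apply/eqP.
  have := congr1 (fun w : lie d => w j (l : nat)) (Xi_reduced Xiw0 redw0).
  by rewrite /w0 ltn_ord subr0.
have {uE} uv : eqmod m u (v b) by apply/trunc_eqmod.
rewrite (_ : u = ladd (v b) (fun j l => u j l - v b j l)).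
  have [_ Xi_add _] := subXi; apply: Xi_add => //.
  by apply: Xi_contains_tail => j l lm; rewrite uv ?subrr.
by apply/funext => j; apply/funext => l; rewrite /ladd addrC subrK.
Qed.

(** The coordinates of row [i] are read off at the row with pivot [t^(n_i) x_i]. By injectivity of
    [p] the sum has at most one term. *)
Definition hermite_coef (A : 'I_K * ('I_d * 'I_m) -> C) : Tidx n -> C :=
  fun x => \sum_(k < K | ((p k).1 == (val x).1.1) && ((p k).2 == n (val x).1.1 :> nat))
    A (k, ((val x).1.2, (val x).2)).

Lemma hermite_coef_polymap : polymap hermite_coef.
Proof. by move=> x; apply: polyfun_sum => k; apply: pf_coord. Qed.

Lemma hermite_coefE A (x : Tidx n) k :
  (p k).1 = (val x).1.1 -> n (val x).1.1 = (p k).2 ->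
  hermite_coef A x = A (k, ((val x).1.2, (val x).2)).
Proof.
move=> ki nk; rewrite /hermite_coef (big_pred1 k) // => k' /=; rewrite nk -ki.
apply/andP/eqP => [[/eqP k1 /eqP k2]|->]; last by rewrite !eqxx.
apply: pivot_inj; move: k1 k2; case: (p k) (p k') => [i l] [i' l'] /= -> l'l.
by congr (_, _); apply: ord_inj.
Qed.

(** A row [i] that carries a coordinate in some column [j] therefore has its pivot [t^(n_i) x_i]
    visible modulo [t^m]. *)
Lemma exponent_lt_sum (i j : 'I_d) : i != j -> (0 < n j)%N -> (n i < m)%N.
Proof.
move=> ij nj; rewrite (bigD1 i) //= (bigD1 j) 1?eq_sym //= addnA.
by apply: leq_trans (leq_addr _ _); rewrite -[X in (X < _)%N]addn0 ltn_add2l.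
Qed.

Lemma first_pivot i : (n i < m)%N -> exists2 k, (p k).1 = i & n i = (p k).2.
Proof.
move=> nim; have [k pk] := (p_image (i, Ordinal nim)).2 (leqnn _).
by exists k; rewrite pk.
Qed.

Lemma hermite_rrefK : cancel hermite_rref hermite_coef.
Proof.
move=> a; apply/funext => x; have /andP[ij lt_n] := valP x.
have nlt : (n (val x).1.1 < m)%N.
  apply: (@exponent_lt_sum _ (val x).1.2); [|exact: leq_ltn_trans lt_n].
  by apply: contraTneq ij => ->; rewrite ltnn.
have [k ki nk] := first_pivot nlt.
rewrite (hermite_coefE _ ki nk).
rewrite /hermite_rref /prow /= ki -nk subnn /= /Trow ij Tcoef_coord ifF //.
by apply: contraTF ij => /eqP->; rewrite ltnn.
Qed.

Lemma hermite_coefK A : rref_at p A -> submodule (preim_span A) ->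
  hermite_rref (hermite_coef A) = A.
Proof.
move=> rrefA subA; have [_ deltaA zeroA] := rrefA.
apply: (rref_at_inj rrefA (hermite_rrefP _)) => k.
set a := hermite_coef A.
(* If the triangular rows lie in the span of [A], so does the module they generate, hence every row
   of its echelon form. *)
suff MT i : preim_span A (Trow a i).
  have : preim_span (hermite_rref a) (prow a k).
    by apply/Xi_hermite_rref; have [] := prow_spec a k.
  by move/Xi_hermite_rref => /(Xi_sub subA MT).
have [nim|nim] := ltnP (n i) m; last first.
  (* Here row [i] has no pivot below degree [m]. All other exponents vanish, and row [i] is zero
     modulo [t^m]. *)
  have n0 j : i != j -> n j = 0%N.
    move=> ij; apply/eqP; rewrite -leqn0 leqNgt; apply: contraTN nim.
    by rewrite -ltnNge; apply: exponent_lt_sum.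
  have [M0 _ _] := subA; apply: preim_span_eqmod M0 => j l lm.
  have [<-|ij] := eqVneq i j.
    by rewrite Trow_diag ltn_eqF // (leq_trans lm).
  by rewrite Trow_ge ?n0 // (negPf ij) mul0r.
have [k' ki nk] := first_pivot nim.
apply: preim_span_eqmod (preim_span_mrow A k') => j l lm.
rewrite -[l]/(val (Ordinal lm)) /mrow liftE.
move: (Ordinal lm) => {lm}l; rewrite /=.
have [njl|lnj] := leqP (n j) l.
  have [k2 pk2] := (p_image (j, l)).2 njl; rewrite -pk2 deltaA Trow_ge //.
  rewrite -(inj_eq pivot_inj) pk2 -[(j, l) == _]/((j == _) && (l == _)) ki.
  rewrite -[l == (p k').2]val_eqE /= -nk eq_sym.
  by case: eqP => [->|_] /=; rewrite ?mul1r ?mul0r.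
have [ji|ij|/val_inj ij] := ltngtP j i.
- rewrite Trow_lt // zeroA // enum_rank_lex /lex ki /=; by rewrite ji.
- have Px : (nat_of_ord i < j)%N && (l < n j)%N by rewrite ij.
  pose x : Tidx n := Sub (i, j, l) Px.
  have := Tcoef_coord a x; rewrite /a (@hermite_coefE _ x k' ki nk) /= => <-.
  by rewrite /Trow ij ifF //; apply: contraTF ij => /eqP->; rewrite ltnn.
- subst j; rewrite Trow_diag ltn_eqF // zeroA // enum_rank_lex /lex ki /= eqxx -nk.
  by rewrite lnj orbT.
Qed.

Lemma Bset_at_EFset (c : sconst d) kd a :
  closed_kind c kd (Xi a) <-> Bset_at c kd p (hermite_rref a).
Proof.
have -> : Xi a = preim_span (hermite_rref a).
  by apply/predeqP => u; apply: Xi_hermite_rref.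
by split=> [|[]//]; split=> //; apply: hermite_rrefP.
Qed.

End HermiteRows.

(** * Torus action and stratification *)

Section Torus.

Variables (d : nat) (n : 'I_d -> nat) (l : 'I_d -> int).
Implicit Types (a : Tidx n -> C) (z : C).

(** Scaling [x_j] multiplies [a_ij] by [z^(l_j)]; dividing row [i] by [z^(l_i)] restores its
    diagonal entry [t^(n_i)]. *)
Definition weight (x : Tidx n) : int := l (val x).1.2 - l (val x).1.1.

Lemma Tcoef_torus z a i j t :
  Tcoef (torus_act weight z a) i j t = z ^ (l j - l i) * Tcoef a i j t.
Proof.
have [h|h] := boolP (t < \sum_i n i)%N; last by rewrite !Tcoef_oob // mulr0.
rewrite !(TcoefE _ _ _ h); case: insubP => [x _ xE|_] /=; last by rewrite mulr0.
by rewrite /torus_act /weight xE.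
Qed.

Lemma Trow_torus z a i : z != 0 ->
  diag_scale z l (Trow a i) =
  fun j t => z ^ (l i) * Trow (torus_act weight z a) i j t.
Proof.
move=> z0; apply/funext => j; apply/funext => t; rewrite /diag_scale /Trow.
case: eqP => [->//|_]; case: ifP => _; last by rewrite !mulr0.
by rewrite Tcoef_torus mulrA -expfzDr // addrC subrK.
Qed.

Lemma Xi_torus z a u : z != 0 ->
  Xi a u -> Xi (torus_act weight z a) (diag_scale z l u).
Proof.
move=> z0; have subXi := Xi_submodule (torus_act weight z a).
have [Xi0 Xi_add Xi_scale] := subXi.
apply: (Xi_sub (M := fun u => Xi _ (diag_scale z l u))) => [|i].
  split.
  - rewrite (_ : diag_scale _ _ _ = @lzero d) //.
    by apply/funext => j; apply/funext => t; rewrite /diag_scale mulr0.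
  - move=> v w Xv Xw.
    rewrite (_ : diag_scale _ _ _ = ladd (diag_scale z l v) (diag_scale z l w)).
      exact: Xi_add.
    by apply/funext => j; apply/funext => t; rewrite /diag_scale /ladd mulrDr.
  - move=> s v Xv; rewrite (_ : diag_scale _ _ _ = lscale s (diag_scale z l v)).
      exact: Xi_scale.
    by apply/funext => j; rewrite /diag_scale /lscale psmul_scaler.
by rewrite Trow_torus //; apply: submodule_const => //; apply: Xi_Trow.
Qed.

(** The scaling by [z] carries [Xi a] onto the module of the transformed matrix, with inverse the
    scaling by [z^-1], and it respects the bracket. *)
Lemma closed_kind_torus (c : sconst d) kd z a :
  (forall z, z != 0 -> lie_aut c (diag_scale z l)) -> z != 0 ->
  closed_kind c kd (Xi a) -> closed_kind c kd (Xi (torus_act weight z a)).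
Proof.
move=> aut z0; have zV0 : z^-1 != 0 by rewrite invr_eq0.
have [_ _ _ brD] := aut z z0.
have DK (u : lie d) : diag_scale z l (diag_scale z^-1 l u) = u.
  apply/funext => j; apply/funext => t.
  by rewrite /diag_scale mulrA -expfzMl mulfV // exp1rz mul1r.
have XiV u : Xi (torus_act weight z a) u -> Xi a (diag_scale z^-1 l u).
  by move=> /(Xi_torus zV0); rewrite torus_actK.
case: kd => /= -[_ closedX]; split; try exact: Xi_submodule.
- move=> u v /XiV Xu /XiV Xv; rewrite -(DK u) -(DK v) -brD.
  exact/Xi_torus/closedX.
- move=> u v /XiV Xv; rewrite -(DK u) -(DK v) -brD.
  exact/Xi_torus/closedX.
Qed.

End Torus.

(** * Pivots and strata of the Grassmannian *)

Definition pivots_of d (n : 'I_d -> nat) m K (p : 'I_K -> 'I_d * 'I_m) : Prop :=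
  (forall k k' : 'I_K, (k < k')%N -> (enum_rank (p k) < enum_rank (p k'))%N) /\
  (forall j : 'I_d * 'I_m, (exists k, p k = j) <-> (n j.1 <= j.2)%N).

Lemma card_ord_lt m k : (k <= m)%N -> #|[pred l : 'I_m | (l < k)%N]| = k.
Proof.
move=> km; rewrite -sum1_card (eq_bigl (fun l : 'I_m => (l < k)%N)) //.
by rewrite (big_ord_narrow km) sum1_card card_ord.
Qed.

Lemma card_pairs d m (P : pred ('I_d * 'I_m)) :
  #|P| = (\sum_i #|[pred l | P (i, l)]|)%N.
Proof.
rewrite -sum1_card; under [RHS]eq_bigr do rewrite -sum1_card.
by rewrite pair_big_dep; apply: eq_bigl => -[i l].
Qed.

Lemma leq_sum_mul d (n : 'I_d -> nat) : (\sum_i n i <= d * \sum_i n i)%N.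
Proof.
case: d n => [|d] n; first by rewrite big_ord0.
by rewrite mulSn leq_addr.
Qed.

Lemma pivots_exist d (n : 'I_d -> nat) :
  exists p : 'I_(d * \sum_i n i - \sum_i n i) -> 'I_d * 'I_(\sum_i n i), pivots_of n p.
Proof.
set m := (\sum_i n i)%N.
pose P (j : 'I_d * 'I_m) := (n j.1 <= j.2)%N.
pose s := [seq j <- enum {: 'I_d * 'I_m} | P j].
have size_s : (d * m - m)%N = size s.
  have -> : size s = #|P|.
    by rewrite cardE /s; congr size; rewrite enumT.
  (* Column [i] has [n_i] non-pivots, so there are [m] in all, leaving [d * m - m] pivots. *)
  have := cardC P; rewrite card_prod !card_ord => <-.
  rewrite [#|predC P|]card_pairs (eq_bigr n) ?addnK // => i _.
  rewrite -[RHS](@card_ord_lt m); last by rewrite /m (bigD1 i) //= leq_addr.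
  by apply: eq_card => l; rewrite !inE /P /= -ltnNge.
rewrite size_s; exists (tnth (in_tuple s)); split=> [k k' kk'|j].
  have lex_s : pairwise (@lex d m) s.
    by apply: subseq_pairwise (pairwise_lex_enum d m); apply: filter_subseq.
  have x0 := tnth (in_tuple s) k; rewrite enum_rank_lex !(tnth_nth x0).
  by apply: (elimT (pairwiseP _) lex_s) => //; rewrite inE ltn_ord.
have -> : (n j.1 <= j.2)%N = (j \in s) by rewrite mem_filter mem_enum andbT.
split=> [[k <-]|/(nthP j)[k ks <-]]; first exact: mem_tnth.
by exists (Ordinal ks); rewrite (tnth_nth j).
Qed.

Lemma pivots_unique d (n : 'I_d -> nat) m K (p p' : 'I_K -> 'I_d * 'I_m) :
  pivots_of n p -> pivots_of n p' -> p = p'.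
Proof.
move=> [mono_p im_p] [mono_p' im_p'].
have sorted_codom (q : 'I_K -> 'I_d * 'I_m) :
    (forall k k' : 'I_K, (k < k')%N -> (enum_rank (q k) < enum_rank (q k'))%N) ->
    sorted (fun x y : 'I_d * 'I_m => enum_rank x < enum_rank y)%N (map q (enum 'I_K)).
  move=> mono_q; apply: pairwise_sorted; rewrite pairwise_map.
  by apply: sub_pairwise (pairwise_ltn_enum K).
have eq_mem : map p (enum 'I_K) =i map p' (enum 'I_K).
  move=> j; apply/mapP/mapP => -[k _ ->].
    have [k' <-] := (im_p' (p k)).2 ((im_p _).1 (ex_intro _ k erefl)).
    by exists k'; rewrite ?mem_enum.
  have [k' <-] := (im_p (p' k)).2 ((im_p' _).1 (ex_intro _ k erefl)).
  by exists k'; rewrite ?mem_enum.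
have : map p (enum 'I_K) = map p' (enum 'I_K).
  apply: irr_sorted_eq eq_mem; try exact: sorted_codom.
    by move=> x y z; apply: ltn_trans.
  by move=> x; apply: ltnn.
by move=> /eq_in_map eq_p; apply/funext => k; apply: eq_p; rewrite mem_enum.
Qed.

(** If the two pivots of a row differed, its entry at the earlier one would be both 1 and 0. *)
Lemma rref_at_pivots K (J : finType) (p p' : 'I_K -> J) A :
  rref_at p A -> rref_at p' A -> p = p'.
Proof.
move=> [_ delta zero] [_ delta' zero']; apply/funext => k; apply: enum_rank_inj.
apply: ord_inj; have [lt|lt|//] := ltngtP (enum_rank (p k)) (enum_rank (p' k)).
  by have /eqP := zero' _ _ lt; rewrite delta eqxx oner_eq0.
by have /eqP := zero _ _ lt; rewrite delta' eqxx oner_eq0.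
Qed.

Section LeadingPivot.

Variables (K : nat) (J : finType) (p : 'I_K -> J) (A : 'I_K * J -> C).
Hypothesis rrefA : rref_at p A.

(** In the pivot expansion of [v j], pivots before [j] have coefficient zero and rows with pivot
    after [j] vanish at [j]. *)
Lemma leading_is_pivot (v : J -> C) (j : J) : rowspan A v -> v j != 0 ->
  (forall j', (enum_rank j' < enum_rank j)%N -> v j' = 0) -> exists k, p k = j.
Proof.
move=> /(rowspan_pivotP rrefA) vE vj0 v0; have [_ _ zeroA] := rrefA.
apply: contrapT => no_k; case/eqP: vj0; rewrite vE big1 // => k _.
have [lt|lt|eq_r] := ltngtP (enum_rank (p k)) (enum_rank j).
- by rewrite v0 ?mul0r.
- by rewrite zeroA ?mulr0.
- by case: no_k; exists k; apply/enum_rank_inj/ord_inj.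
Qed.

End LeadingPivot.

Lemma down_closed_card m (D : pred 'I_m) :
  (forall l l' : 'I_m, (l < l')%N -> D l' -> D l) ->
  forall l : 'I_m, D l = (l < #|D|)%N.
Proof.
move=> downD l; apply/idP/idP => [Dl|].
  rewrite -(card_ord_lt (ltn_ord l)); apply: subset_leq_card.
  apply/fintype.subsetP => l'; rewrite !inE /= ltnS leq_eqVlt.
  by move=> /orP[/eqP/ord_inj->|/downD/(_ Dl)].
apply: contraTT => nDl; rewrite -leqNgt -[leqRHS](card_ord_lt (ltnW (ltn_ord l))).
apply: subset_leq_card; apply/fintype.subsetP => l'; rewrite !inE /= => Dl'.
rewrite ltnNge leq_eqVlt; apply: contra nDl => /orP[/eqP/ord_inj->//|].
by move=> /downD; apply.
Qed.

Lemma closed_kind_submodule d (c : sconst d) kd M : closed_kind c kd M -> submodule M.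
Proof. by case: kd => -[]. Qed.

(** Multiplication by [t] moves a leading monomial one degree up, so the non-pivots of each column
    form an initial segment. Its length is [n_i], and the lengths add up to the codimension [m]. *)
Lemma Bset_pivots d (c : sconst d) kd m A : Bset c kd A ->
  exists2 n : 'I_d -> nat, (\sum_i n i)%N = m &
    exists2 p : 'I_(d * m - m) -> 'I_d * 'I_m, pivots_of n p & Bset_at c kd p A.
Proof.
case=> le_m [p rrefA] closedA; have [mono_p deltaA zeroA] := rrefA.
have [_ _ scaleM] : submodule (preim_span A) := closed_kind_submodule closedA.
have succ_pivot k (l' : 'I_m) : l' = (p k).2.+1 :> nat ->
    exists k', p k' = ((p k).1, l').
  move=> l'E; have spanS := scaleM (psX 1) _ (preim_span_mrow A k).
  have shiftE i (t : 'I_m) : trunc (lscale (psX 1) (mrow A k)) (i, t) =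
      if (1 <= t)%N then mrow A k i (t - 1)%N else 0 by exact: psmulX.
  apply: (leading_is_pivot rrefA spanS).
    rewrite shiftE l'E /= subn1 /= /mrow liftE -surjective_pairing.
    by rewrite deltaA eqxx oner_eq0.
  move=> [i t]; rewrite enum_rank_lex /lex /= shiftE => lt_it.
  case: ifP => // t1; have tm : (t - 1 < m)%N by have := ltn_ord t; lia.
  rewrite -[(t - 1)%N]/(val (Ordinal tm)) /mrow liftE zeroA // enum_rank_lex /lex /=.
  case/orP: lt_it => [->//|/andP[-> tl]]; apply/orP; right.
  by rewrite /= ltn_subLR // add1n -l'E.
have up_pivot i t (l l' : 'I_m) : l' = (l + t)%N :> nat ->
    (i, l) \in codom p -> (i, l') \in codom p.
  elim: t l' => [|t IHt] l' l'E pl.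
    by rewrite (_ : l' = l) //; apply: ord_inj; rewrite l'E addn0.
  have tm : (l + t < m)%N by rewrite (leq_trans _ (ltn_ord l')) // l'E addnS.
  have /codomP[k pk] := IHt (Ordinal tm) erefl pl.
  have [|k' pk'] := succ_pivot k l'; first by rewrite -pk l'E addnS.
  by apply/codomP; exists k'; rewrite pk' -pk.
pose D i := [pred l | (i, l) \notin codom p].
have downD i (l l' : 'I_m) : (l < l')%N -> D i l' -> D i l.
  move=> /ltnW ll'; rewrite /D /=; apply: contra.
  by apply: (up_pivot _ (l' - l)%N); rewrite subnKC.
have pivot_inj : injective p.
  move=> k k' pkk'; apply: ord_inj.
  have [/mono_p|/mono_p|] := ltngtP k k'; by rewrite ?pkk' ?ltnn.
exists (fun i => #|D i|).
  rewrite -(card_pairs [pred j | j \notin codom p]).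
  apply: (@addnI #|codom p|); rewrite cardC card_prod !card_ord card_codom //.
  by rewrite card_ord subnK.
exists p; split=> // -[i l] /=; rewrite leqNgt -(down_closed_card (downD i)).
by rewrite /D /= negbK; split=> [[k <-]|/codomP[k ->]]; [exact: codom_f | exists k].
Qed.

(** Quantifying over [p] gives a set for every [n], empty when no pivot map fits; otherwise
    [pivots_unique] determines [p]. *)
Definition stratum d (c : sconst d) kd m K (n : 'I_d -> nat)
    (A : 'I_K * ('I_d * 'I_m) -> C) : Prop :=
  exists2 p, pivots_of n p & Bset_at c kd p A.

Lemma constructible_stratum d (c : sconst d) kd m K n :
  constructible (@stratum d c kd m K n).
Proof.
have [[p pivp]|no_p] := pselect (exists p : 'I_K -> 'I_d * 'I_m, pivots_of n p).
  apply: cons_ext (constructible_Bset_at c kd p) => A.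
  by split=> [|[p' pivp']]; [exists p | rewrite (pivots_unique pivp pivp')].
apply: cons_ext (constructible_const _ False) => A; split=> // -[p pivp _].
by apply: no_p; exists p.
Qed.

Lemma stratum_inj d (c : sconst d) kd m K (n n' : {ffun 'I_d -> 'I_m.+1}) A :
  @stratum d c kd m K (fun i => n i) A -> @stratum d c kd m K (fun i => n' i) A ->
  n = n'.
Proof.
move=> [p [_ im_p] [rrefA _]] [p' [_ im_p'] [rrefA' _]].
rewrite -(rref_at_pivots rrefA rrefA') in im_p'.
apply/ffunP => i; apply: ord_inj.
(* Both sides say that [t^l x_i] is a pivot. Two distinct exponents at most [m] are separated by the
   smaller one, which is below [m]. *)
have le_n (l : 'I_m) : (n i <= l)%N = (n' i <= l)%N.
  by apply/idP/idP => [/(im_p (i, l))/im_p'|/(im_p' (i, l))/im_p].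
have := ltn_ord (n i); have := ltn_ord (n' i); rewrite !ltnS => n'm nm.
have [lt|lt|//] := ltngtP (n i) (n' i).
  by have := le_n (Ordinal (leq_trans lt n'm)); rewrite /= leqnn leqNgt lt.
by have := le_n (Ordinal (leq_trans lt nm)); rewrite /= leqnn leqNgt lt.
Qed.

Lemma Bset_strata d (c : sconst d) kd m A :
  @Bset d c kd m A <->
  exists2 n : {ffun 'I_d -> 'I_m.+1},
    n \in enum [pred n : {ffun 'I_d -> 'I_m.+1} | (\sum_i (n i : nat))%N == m] &
    stratum c kd (fun i => n i) A.
Proof.
split=> [/Bset_pivots[n sum_n [p pivp BA]]|[n]].
  have n_lt i : (n i < m.+1)%N by rewrite ltnS -sum_n (bigD1 i) //= leq_addr.
  have nE : (fun i => ([ffun i => Ordinal (n_lt i)] : {ffun _}) i : nat) = n.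
    by apply/funext => i; rewrite ffunE.
  exists [ffun i => Ordinal (n_lt i)]; last by exists p; rewrite ?nE.
  rewrite mem_enum inE; apply/eqP; rewrite -[RHS]sum_n.
  by apply: eq_bigr => i _; rewrite ffunE.
rewrite mem_enum inE => /eqP sum_n [p _ [rrefA closedA]]; split=> //.
  by rewrite -sum_n leq_sum_mul.
by exists p.
Qed.

(** Interpolates between the full set of triangular matrices ([S] empty) and [EFset], so that
    coordinates can be killed one at a time. *)
Definition Fset d (c : sconst d) kd (n : 'I_d -> nat) (S : pred (Tidx n))
    (a : Tidx n -> C) : Prop :=
  (forall x, S x -> a x = 0) /\ closed_kind c kd (Xi a).

(** Closedness of [Xi a] quantifies over power series; pulling [Bset_at] back along the polynomial
    map [hermite_rref] makes it finite. *)
Lemma constructible_Fset d (c : sconst d) kd (n : 'I_d -> nat) (S : pred (Tidx n)) :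
  constructible (Fset c kd S).
Proof.
apply: cons_inter.
  apply: constructible_all => x; apply: constructible_imp.
  by apply: constructible_eq; [apply: pf_coord | apply: pf_const].
have [p [mono_p im_p]] := pivots_exist n.
have poly_rref := hermite_rref_polymap p.
apply: cons_ext (constructible_preim (constructible_Bset_at c kd p) poly_rref) => a.
by rewrite (Bset_at_EFset mono_p im_p).
Qed.

(** * Comparison of Euler characteristics *)

Section Main.

Variables (chi : forall I : finType, ((I -> C) -> Prop) -> int).
Hypothesis chiP : is_euler_char chi.

Lemma chi_stratum d (c : sconst d) kd (n : 'I_d -> nat) :
  chi (@stratum d c kd (\sum_i n i) (d * \sum_i n i - \sum_i n i) n) =
  chi (Fset c kd (n := n) pred0).
Proof.
have [p pivp] := pivots_exist n; have [mono_p im_p] := pivp.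
rewrite (@chi_ext chi _ _ (Bset_at c kd p)); last first.
  move=> A; split=> [[p' pivp']|]; last by exists p.
  by rewrite (pivots_unique pivp pivp').
have closedP a := Bset_at_EFset mono_p im_p c kd a.
have coefK A : Bset_at c kd p A -> hermite_rref p (hermite_coef p A) = A.
  move=> [rrefA closedA]; apply: hermite_coefK => //.
  exact: closed_kind_submodule closedA.
apply: (chi_bij chiP (f := hermite_coef p) (g := hermite_rref p)).
- exact: constructible_Bset_at.
- exact: constructible_Fset.
- exact: hermite_coef_polymap.
- by move=> A BA; split=> //; apply/closedP; rewrite coefK.
- by move=> a [_ /closedP].
- exact: coefK.
- by move=> a _; apply: hermite_rrefK.
Qed.

(** The part with [a x0 != 0] is stable under the torus, and [x0] has nonzero weight, so that part
    contributes 0. *)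
Lemma chi_Fset_removable d (c : sconst d) kd (n : 'I_d -> nat) (S : pred (Tidx n)) x0 :
  removable c (val x0).1.1 (val x0).1.2 ->
  chi (Fset c kd S) = chi (Fset c kd (predU1 x0 S)).
Proof.
move=> [l [l0 aut]].
have cons0 : constructible (fun a : Tidx n -> C => a x0 = 0).
  by apply: constructible_eq; [apply: pf_coord | apply: pf_const].
have consF := constructible_Fset c kd S.
rewrite (chi_setD chiP consF cons0).
rewrite [X in _ + X](chi_torus_act chiP (w := weight l) (x0 := x0)).
- rewrite addr0; apply: chi_ext => a; split=> [[[aS closed_a] ax0]|[aS closed_a]].
    by split=> // x /predU1P[->|/aS].
  split; first by split=> // x Sx; apply: aS; rewrite /= Sx orbT.
  by apply: aS; rewrite /= eqxx.
- by apply: cons_inter => //; apply: cons_compl.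
- by rewrite /weight subr_eq0 eq_sym.
- move=> z a z0 [[aS closed_a] ax0]; split; first split.
  + by move=> x /aS ax; rewrite /torus_act ax mulr0.
  + exact: closed_kind_torus.
  + by move=> /eqP; rewrite mulf_eq0 expfz_eq0 (negPf z0) andbF => /eqP.
- by move=> a [_ /eqP].
Qed.

Lemma chi_EFset d (c : sconst d) kd (Cp : 'I_d -> 'I_d -> Prop) (n : 'I_d -> nat) :
  (forall i j, Cp i j -> removable c i j) ->
  chi (Fset c kd (n := n) pred0) = chi (@EFset d c kd Cp n).
Proof.
move=> remC; pose S (x : Tidx n) := `[< Cp (val x).1.1 (val x).1.2 >].
have step (s : seq (Tidx n)) : all S s ->
    chi (Fset c kd (n := n) pred0) = chi (Fset c kd (mem s)).
  elim: s => [_|x s IHs /= /andP[/asboolP Cx /IHs ->]]; first exact: chi_ext.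
  rewrite (chi_Fset_removable kd (mem s) (remC _ _ Cx)); apply: chi_ext => a.
  by split=> -[aS closed_a]; split=> // y ys; apply: aS; move: ys; rewrite /= inE.
rewrite (step (enum S)); last by apply/allP => x; rewrite mem_enum.
apply: chi_ext => a; split=> -[aS closed_a]; split=> // x.
  by move=> Cx; apply: aS; rewrite /= mem_enum; apply/asboolP.
by rewrite /= mem_enum => /asboolP; apply: aS.
Qed.

End Main.

Theorem theorem3p2 (d : nat) (c : sconst d) (k : kind)
    (Cp : 'I_d -> 'I_d -> Prop)
    (chi : forall I : finType, ((I -> C) -> Prop) -> int) :
  is_lie_algebra c ->
  is_euler_char chi ->
  (forall i j : 'I_d, Cp i j -> (nat_of_ord i < nat_of_ord j)%nat /\ removable c i j) ->
  forall m : nat,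
    chi _ (@Bset d c k m) =
    \sum_(n : {ffun 'I_d -> 'I_m.+1} | (\sum_(i < d) (n i : nat))%nat == m)
       chi _ (@EFset d c k Cp (fun i => (n i : nat))).
Proof.
move=> _ chiP remC m.
(* Both sides are coefficients of [T^m]; exponents with sum [m] are each at most [m], so they index
   finitely many disjoint strata. *)
rewrite (chi_ext chi (@Bset_strata d c k m)) (chi_sum chiP).
- rewrite big_enum_cond /=; apply: eq_big => [n|n]; first by rewrite andbT.
  rewrite andbT => /eqP sum_n; rewrite -(chi_EFset chiP).
    by rewrite -chi_stratum // [in RHS]sum_n.
  by move=> i j /remC[].
- exact: enum_uniq.
- by move=> n; apply: constructible_stratum.
- by move=> n n' A; apply: stratum_inj.
Qed.
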